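(* Let $G$ be a $p$-group of the form $\mathbb{Z}_{p^e}\times\mathbb{Z}_{p^t}$, where $p$ is a prime and $e,t\ge1$, and let $L$ be the Laplacian matrix of $\Gamma(G)$. Then the Laplacian spectrum is $$\mathrm{Spec}(L)=\begin{pmatrix}0&(p+1)\alpha&p\alpha\\ 1+p^{e+t-2}&p&(p+1)(\alpha-1)\end{pmatrix},$$ where $\alpha=\varphi(p^{e+t-1})$.
   Context: The generating graph $\Gamma(G)$ of a group $G$ is the simple graph with vertex set $G$ in which two distinct vertices $x,y$ are adjacent if and only if $\langle x,y\rangle=G$. The Laplacian matrix of a graph is the diagonal degree matrix minus the adjacency matrix. $\varphi$ is the Euler totient function. In the array for $\mathrm{Spec}$, the first row lists the eigenvalues and the second row their respective multiplicities. *)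

(* Defs.v *)
From mathcomp Require Import all_boot all_order all_algebra all_fingroup.

Set Implicit Arguments.
Unset Strict Implicit.
Unset Printing Implicit Defensive.

Import GRing.Theory.
Local Open Scope ring_scope.

(* A finite simple graph is an adjacency relation on a finType; its matrices
   are indexed by the vertices through [enum_val]. *)
Section GraphMatrices.
Variables (R : pzRingType) (T : finType) (adj : rel T).

Definition adjacency_mx : 'M[R]_#|T| :=
  \matrix_(i, j) (adj (enum_val i) (enum_val j))%:R.

Definition degree (x : T) : nat := #|[pred y | adj x y]|.

Definition degree_mx : 'M[R]_#|T| :=
  diag_mx (\row_i (degree (enum_val i))%:R).

Definition laplacian_mx : 'M[R]_#|T| := degree_mx - adjacency_mx.

End GraphMatrices.

Definition generating_graph (gT : finGroupType) : rel gT :=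
  [rel x y | (x != y) && (<<[set x; y]>>%g == [set: gT])].

(* [s] lists pairs (eigenvalue, algebraic multiplicity). A pair (a, 0) is
   allowed, and says that a is not an eigenvalue: a general formula may give
   multiplicity 0 for some values of its parameters. *)
Definition has_spectrum (F : fieldType) (n : nat) (A : 'M[F]_n)
    (s : seq (F * nat)) : Prop :=
  [/\ uniq (unzip1 s),
      forall a : F, eigenvalue A a <-> (exists2 m, (a, m) \in s & (0 < m)%N)
    & forall (a : F) (m : nat), (a, m) \in s -> mup a (char_poly A) = m].

(* Main.v *)
Require Import Defs.
From mathcomp Require Import all_boot all_order all_algebra all_fingroup.
From mathcomp Require Import all_solvable ring.

(* G / Phi(G) has order p^2, and two elements of G generate G iff their images
   in G / Phi(G) span two distinct lines. Hence the generating graph is the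
   disjoint union of the isolated points of Phi(G) and of a complete
   multipartite graph with one part of size |Phi(G)| (p - 1) for each of the
   p + 1 lines. The Laplacian of such a graph is D - P (J - 1) P^T with D
   diagonal and P the vertex-part incidence matrix; as P^T E P is scalar when E
   is diagonal and constant on the non-isolated vertices, the identity
   det (1 + A B) = det (1 + B A) reduces its characteristic polynomial to a
   determinant on the parts, of the form det (s 1 + t J). *)

Set Implicit Arguments.
Unset Strict Implicit.
Unset Printing Implicit Defensive.

Import GRing.Theory Num.Theory.

(** * Determinant identities and spectra read off a factored characteristic polynomial *)

Section CharacteristicPolynomials.
Local Open Scope ring_scope.

(** The block matrix with rows [1, -A] and [B, 1] factors in two ways into block triangular
    matrices, and each side is the determinant of one factorization. *)
Lemma det_1D_mulmx (R : comPzRingType) (m n : nat)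
    (A : 'M[R]_(m, n)) (B : 'M[R]_(n, m)) :
  \det (1%:M + A *m B) = \det (1%:M + B *m A).
Proof.
have lhs : block_mx (1%:M + A *m B) (- A) 0 1%:M *m block_mx 1%:M 0 B 1%:M
    = block_mx 1%:M (- A) B 1%:M.
  by rewrite mulmx_block !(mulmx0, mul0mx, mulmx1, mul1mx, add0r) mulNmx addrK.
have rhs : block_mx 1%:M 0 B 1%:M *m block_mx 1%:M (- A) 0 (1%:M + B *m A)
    = block_mx 1%:M (- A) B 1%:M.
  rewrite mulmx_block !(mulmx0, mul0mx, mulmx1, mul1mx, addr0) mulmxN.
  by rewrite [- (B *m A) + _]addrC addrK.
have := congr1 determinant (etrans lhs (esym rhs)).
by rewrite !det_mulmx !det_ublock !det_lblock !det1 !mulr1 !mul1r.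
Qed.

(** A constant matrix is a column times a row, so after factoring out [a] the previous lemma leaves
    a 1 by 1 determinant. *)
Lemma det_scalarD_const_mx (F : fieldType) (n : nat) (a b : F) :
  a != 0 -> \det (a%:M + const_mx b : 'M[F]_n) = a ^+ n * (1 + n%:R * (b / a)).
Proof.
move=> a0.
have -> : a%:M + const_mx b
    = a *: (1%:M + (const_mx 1 : 'M[F]_(n, 1)) *m const_mx (b / a)) :> 'M[F]_n.
  rewrite scalerDr scalemx1; congr (_ + _); apply/matrixP=> i j.
  by rewrite !mxE big_ord1 !mxE mul1r mulrC divfK.
rewrite detZ det_1D_mulmx det_mx11 !mxE; congr (_ * (_ + _)).
under eq_bigr do rewrite !mxE mulr1.
by rewrite sumr_const card_ord mulr_natl.
Qed.

(** In characteristic 0 the naturals are pairwise distinct, so a nonzero [P - Q] would have more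
    roots than its degree allows. *)
Lemma poly_eq_nat_evals (R : numDomainType) (P Q : {poly R}) :
  (forall n : nat, P.[n%:R] = Q.[n%:R]) -> P = Q.
Proof.
move=> PQ; apply/eqP; rewrite -subr_eq0; apply: contraT => nz.
have := max_poly_roots nz (rs := [seq i%:R | i <- iota 0 (size (P - Q))]).
rewrite size_map size_iota ltnn; apply.
  by apply/allP=> _ /mapP[i _ ->]; rewrite /root !hornerE PQ subrr.
by rewrite map_inj_uniq ?iota_uniq // => i j /eqP; rewrite eqr_nat => /eqP.
Qed.

Lemma horner_char_poly (R : comNzRingType) (n : nat) (A : 'M[R]_n) (x : R) :
  (char_poly A).[x] = \det (x%:M - A).
Proof.
rewrite -horner_evalE -det_map_mx; congr determinant.
apply/matrixP=> i j; rewrite !mxE rmorphB /= rmorphMn /= !horner_evalE.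
by rewrite hornerX hornerC.
Qed.

Lemma mup_prod_XsubC (F : fieldType) (s : seq (F * nat)) (a : F) :
  mup a (\prod_(z <- s) ('X - z.1%:P) ^+ z.2)
    = (\sum_(z <- s | z.1 == a) z.2)%N.
Proof.
elim: s => [|z s IHs]; first by rewrite !big_nil mupNroot // root1.
have nz (r : seq (F * nat)) : \prod_(y <- r) ('X - y.1%:P) ^+ y.2 != 0.
  by rewrite prodf_seq_neq0; apply/allP=> y _; rewrite expf_neq0 ?polyXsubC_eq0.
rewrite !big_cons mupM ?expf_neq0 ?polyXsubC_eq0 // IHs mup_XsubCX.
by case: eqP.
Qed.

(** Since the listed values are distinct, only one factor contributes to the multiplicity at each of
    them; a factor with exponent 0 equals 1 and yields no eigenvalue. *)
Lemma has_spectrum_char_poly (F : fieldType) (n : nat) (A : 'M[F]_n)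
    (s : seq (F * nat)) :
    uniq (unzip1 s) ->
    char_poly A = \prod_(z <- s) ('X - z.1%:P) ^+ z.2 ->
  has_spectrum A s.
Proof.
move=> us charA.
have mupA a m : (a, m) \in s -> mup a (char_poly A) = m.
  rewrite charA mup_prod_XsubC.
  elim: s us {charA} => //= [[b k]] s IHs /andP[nb us].
  rewrite big_cons inE /= => /orP[/eqP[-> ->]|ams].
    rewrite eqxx big_seq_cond big1 ?addn0 // => z /andP[zs /eqP ez].
    by rewrite /= -ez (map_f fst zs) in nb.
  rewrite (IHs us ams); case: eqP => // ba.
  by rewrite ba in nb; rewrite (map_f fst ams) in nb.
split=> // a; have mA := monic_neq0 (char_poly_monic A).
rewrite eigenvalue_root_char root_factor_theorem XsubC_dvd //.
split=> [|[m am m0]]; last by rewrite (mupA _ _ am).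
rewrite charA mup_prod_XsubC lt0n sum_nat_seq_neq0.
move=> /hasP[[b m] bm /andP[/eqP <- m0]].
by exists m; rewrite // lt0n.
Qed.

End CharacteristicPolynomials.

(** * Complete multipartite graphs with equal parts and isolated points *)

Section CompleteMultipartite.
Local Open Scope ring_scope.

Variables (R : numFieldType) (T C : finType) (V : {set T}) (g : T -> C).
Variables (adj : rel T) (a : nat).
Hypothesis adjE : forall x y, adj x y = [&& x \in V, y \in V & g x != g y].
Hypothesis card_class : {in V, forall x, #|[set y in V | g y == g x]| = a}.

Lemma card_multipartite : #|V| = (#|g @: V| * a)%N.
Proof.
rewrite -sum1_card (partition_big_imset g) /= -sum_nat_const.
apply: eq_bigr => _ /imsetP[x Vx ->]; rewrite -(card_class Vx) sum1dep_card.
by apply: eq_card => y; rewrite !inE.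
Qed.

Variable q : nat.
Hypothesis card_classes : #|g @: V| = q.+1.

Lemma class_size_gt0 : (0 < a)%N.
Proof.
have /card_gt0P[_ /imsetP[x Vx _]] : (0 < #|g @: V|)%N by rewrite card_classes.
by rewrite -(card_class Vx); apply/card_gt0P; exists x; rewrite !inE Vx /=.
Qed.

Lemma multipartite_degree x :
  degree adj x = if x \in V then (q * a)%N else 0%N.
Proof.
rewrite /degree; case: ifPn => Vx; last first.
  by apply: eq_card0 => y; rewrite !inE adjE (negPf Vx).
have := cardsID [set y | g y == g x] V.
rewrite card_multipartite card_classes mulSn.
rewrite (_ : V :&: _ = [set y in V | g y == g x]); last first.
  by apply/setP=> y; rewrite !inE.
rewrite (card_class Vx) => /addnI <-.
by apply: eq_card => y; rewrite !inE adjE Vx andTb eq_sym andbC.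
Qed.

Definition class_incidence_mx : 'M[R]_(#|T|, #|g @: V|) :=
  \matrix_(i, c) ((enum_val i \in V) && (g (enum_val i) == enum_val c))%:R.

Local Notation P := class_incidence_mx.

Lemma sum_class_incidence x (F : 'I_#|g @: V| -> R) (Vx : x \in V) :
  \sum_c (g x == enum_val c)%:R * F c
    = F (enum_rank_in (imset_f g Vx) (g x)).
Proof.
rewrite (bigD1 (enum_rank_in (imset_f g Vx) (g x))) //=.
rewrite enum_rankK_in ?imset_f // eqxx mul1r big1 ?addr0 // => c.
move=> ne; case: eqP => [e|]; last by rewrite mul0r.
by rewrite -(enum_valK_in (imset_f g Vx) c) -e eqxx in ne.
Qed.

(** The row of [P] at a vertex sums to 1 on [V] and to 0 off it, so with J the all-ones matrix, P J
    P^T marks all pairs in [V]. Subtracting P P^T removes the pairs lying in one part. *)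
Lemma multipartite_adjacency_mx :
  adjacency_mx R adj = P *m (const_mx 1 - 1%:M) *m P^T.
Proof.
apply/matrixP=> i j; rewrite mulmxBr mulmx1 mulmxBl !mxE adjE.
set x := enum_val i; set y := enum_val j.
have Pij : \sum_c P i c * P^T c j = [&& x \in V, y \in V & g x == g y]%:R.
  under eq_bigr do rewrite !mxE -/x -/y.
  case Vx: (x \in V); last by rewrite big1 // => c _; rewrite mul0r.
  rewrite /= (sum_class_incidence _ Vx) enum_rankK_in ?imset_f //.
  by rewrite [g y == _]eq_sym.
have row1 z : z \in V ->
    \sum_(c < #|g @: V|) ((z \in V) && (g z == enum_val c))%:R = 1 :> R.
  move=> Vz; rewrite -[RHS](sum_class_incidence (fun=> 1) Vz).
  by apply: eq_bigr => c _; rewrite mulr1 Vz.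
have -> : \sum_c (P *m const_mx 1) i c * P^T c j = [&& x \in V & y \in V]%:R.
  under eq_bigr => c _.
    rewrite !mxE -/y; under eq_bigr do rewrite !mxE mulr1 -/x.
    over.
  rewrite -mulr_sumr.
  case Vx: (x \in V); last by rewrite big1 ?mul0r.
  case Vy: (y \in V); last by rewrite [X in _ * X]big1 ?mulr0.
  have := row1 _ Vx; rewrite Vx => ->; have := row1 _ Vy; rewrite Vy => ->.
  by rewrite mulr1.
rewrite Pij; case: (x \in V) => /=; last by rewrite subrr.
case: (y \in V) => /=; last by rewrite subrr.
by case: eqP; rewrite ?subrr ?subr0.
Qed.

(** The columns of [P] are indicators of disjoint parts, which kills the off-diagonal entries; each
    diagonal entry sums [s] over the [a] vertices of a part. *)
Lemma class_incidence_gram (r : T -> R) (s : R) : {in V, forall x, r x = s} ->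
  P^T *m diag_mx (\row_i r (enum_val i)) *m P = (a%:R * s)%:M.
Proof.
move=> rV; rewrite mul_mx_diag; apply/matrixP=> c c'; rewrite !mxE.
under eq_bigr do rewrite !mxE.
rewrite -(big_enum_val (A := T) (fun x =>
  ((x \in V) && (g x == enum_val c))%:R * r x *
  ((x \in V) && (g x == enum_val c'))%:R)) /=.
have [x Vx cE] : exists2 x, x \in V & enum_val c = g x.
  by have /imsetP[x] := enum_valP c; exists x.
transitivity (\sum_(y in [set y in V | g y == g x]) s *+ (c == c')).
  rewrite [RHS]big_mkcond /=; apply: eq_bigr => y _; rewrite !inE -cE.
  case Vy: (y \in V); rewrite ?mul0r //=.
  have [gy|_] := eqVneq (g y); rewrite ?mul0r //.
  rewrite mul1r gy (inj_eq enum_val_inj) rV //.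
  by case: (c == c'); rewrite ?mulr1 ?mulr0.
by rewrite sumr_const (card_class Vx) mulrnAC mulr_natl.
Qed.

Lemma multipartite_char_poly :
  char_poly (laplacian_mx R adj)
    = 'X ^+ (1 + #|~: V|) * ('X - (q.+1 * a)%:R%:P) ^+ q
      * ('X - (q * a)%:R%:P) ^+ (q.+1 * (a - 1)).
Proof.
(* Away from the roots of h, all the matrices inverted below are invertible. *)
pose h : {poly R} := 'X * ('X - (q * a)%:R%:P) * ('X - (q.+1 * a)%:R%:P).
have hn0 : h != 0 by rewrite !mulf_neq0 ?polyX_eq0 ?polyXsubC_eq0.
apply: (mulIf hn0); apply: poly_eq_nat_evals => n.
rewrite ![(_ * h).[_]]hornerM.
have [->|] := eqVneq h.[n%:R] 0; first by rewrite !mulr0.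
move=> nzh; congr (_ * _); move: nzh; rewrite /h !hornerE /=; set x : R := n%:R.
rewrite !mulf_eq0 !negb_or -andbA => /and3P[x0 xd xk].
rewrite horner_char_poly.
(* [r] is the diagonal of x - D, as vertices off [V] have degree 0. *)
pose r (y : T) : R := if y \in V then x - (q * a)%:R else x.
have r0 y : r y != 0 by rewrite /r; case: ifP.
pose E : 'M[R]_#|T| := diag_mx (\row_i r (enum_val i)).
pose E' : 'M[R]_#|T| := diag_mx (\row_i (r (enum_val i))^-1).
have EE' : E *m E' = 1%:M.
  by rewrite mulmx_diag; apply/matrixP=> i j; rewrite !mxE mulfV.
(* Once [E] is factored out, the remaining term passes through the space of parts, so [det_1D_mulmx]
   brings the determinant down to size [q.+1]. *)
have -> : x%:M - laplacian_mx R adj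
    = E *m (1%:M + (E' *m P) *m ((const_mx 1 - 1%:M) *m P^T)).
  rewrite mulmxDr mulmx1 !mulmxA EE' mul1mx -multipartite_adjacency_mx.
  rewrite /laplacian_mx opprB addrCA addrC; congr (_ + _).
  apply/matrixP=> i j; rewrite !mxE -mulrnBl multipartite_degree /r.
  by case: ifP; rewrite ?subr0.
rewrite det_mulmx det_1D_mulmx -!mulmxA [P^T *m _]mulmxA.
rewrite (@class_incidence_gram (fun y => (r y)^-1) (x - (q * a)%:R)^-1);
  last by move=> y Vy; rewrite /r Vy.
set b := a%:R / _.
rewrite mul_mx_scalar scalerBr scalemx1.
have -> : 1%:M + (b *: const_mx 1 - b%:M)
    = (1 - b)%:M + const_mx b :> 'M[R]_#|g @: V|.
  by apply/matrixP=> i j; rewrite !mxE mulr1 mulrnBl addrCA addrC.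
have b1 : 1 - b = (x - (q.+1 * a)%:R) / (x - (q * a)%:R).
  by rewrite /b mulSn natrD; move: ((q * a)%:R : R) xd => d xd; field.
rewrite det_scalarD_const_mx; last first.
  by rewrite b1 mulf_neq0 ?invr_neq0.
rewrite card_classes.
(* The last exponent is [#|V|], that is [q.+1 * a], split so that [q.+1] copies cancel the
   denominators of [(1 - b) ^+ q.+1]. *)
have -> : \det E = x ^+ #|~: V| * (x - (q * a)%:R) ^+ (q.+1 * (a - 1) + q.+1).
  rewrite det_diag; under eq_bigr do rewrite mxE.
  rewrite -(big_enum_val (A := T) r) /= (bigID (mem V)) /= mulrC; congr (_ * _).
    rewrite -prodr_const; apply: eq_big => y; first by rewrite !inE.
    by rewrite /r => /negPf->.
  rewrite -mulnSr subn1 prednK ?class_size_gt0 //.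
  rewrite -card_classes -card_multipartite.
  by rewrite -prodr_const; apply: eq_bigr => y; rewrite /r => ->.
rewrite b1 /b; set d := x - (q * a)%:R; set c := x - (q.+1 * a)%:R.
have [d0 c0] : d != 0 /\ c != 0 by [].
have -> : 1 + q.+1%:R * (a%:R / d / (c / d)) = x / c.
  have -> : x = c + q.+1%:R * a%:R by rewrite /c natrM subrK.
  by move: c d c0 d0 => c d c0 d0; field; rewrite c0.
rewrite expr_div_n exprD add1n !exprS.
have : d ^+ q != 0 by rewrite expf_neq0.
move: (d ^+ q) (c ^+ q) (x ^+ _) => dq cq xm dq0.
by move: d c d0 c0 => d c d0 c0; field; rewrite c0 dq0.
Qed.

End CompleteMultipartite.

(** * Generating pairs of a p-group of rank 2, seen modulo its Frattini subgroup *)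

Section GeneratingGraph.
Local Open Scope group_scope.
Variables (gT : finGroupType) (p : nat).
Hypothesis p_prime : prime p.
Hypothesis pG : p.-group [set: gT].
Local Notation Phi := 'Phi([set: gT]).
Hypothesis cardQ : #|[set: gT] / Phi| = (p ^ 2)%N.

Local Definition line (x : gT) : {group coset_of Phi} := <[coset Phi x]>%G.

Lemma mem_norm_Phi x : x \in 'N(Phi).
Proof. by have /andP[_ /subsetP->] := Phi_normal [set: gT]; rewrite ?inE. Qed.

Lemma card_line x : x \notin Phi -> #|line x| = p.
Proof.
move=> nx; apply: (abelem_order_p (Phi_quotient_abelem pG)).
  by rewrite mem_quotient ?inE.
by apply: contra nx => /eqP; apply: coset_idr (mem_norm_Phi x).
Qed.

(** Frattini elements are non-generators: if x and y generate modulo Phi, then together with Phi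
    they generate the whole group, hence so do they alone. *)
Lemma gen2_line x y :
  (<<[set x; y]>> == [set: gT]) = (line x <*> line y == [set: gT] / Phi).
Proof.
have sub : [set x; y] \subset 'N(Phi).
  by apply/subsetP=> z _; apply: mem_norm_Phi.
have -> : line x <*> line y = <<[set x; y]>> / Phi.
  rewrite quotient_gen // quotientE morphimEsub // imsetU !imset_set1 /=.
  by rewrite /line /cycle joing_idl joing_idr.
apply/eqP/eqP => [->//|eqQ]; rewrite -[LHS]genGid; apply: Phi_nongen.
rewrite norm_joinEr ?gen_subG // -quotientK ?gen_subG // eqQ quotientK.
  by apply/mulSGid; apply: Phi_sub.
by apply/subsetP=> z _; apply: mem_norm_Phi.
Qed.

Lemma line_Phi x : x \in Phi -> line x = 1%G.
Proof. by move=> Px; apply: val_inj; rewrite /= coset_id // cycle1. Qed.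

Lemma card_line_le x : #|line x| <= p.
Proof.
have [Px|/card_line->//] := boolP (x \in Phi).
by rewrite line_Phi // cards1 prime_gt0.
Qed.

Lemma line_proper x : line x != [set: gT] / Phi :> {set _}.
Proof.
apply: contraTneq (card_line_le x) => ->.
by rewrite cardQ -ltnNge -{1}[p]expn1 ltn_exp2l ?prime_gt1.
Qed.

(** Two distinct subgroups of prime order p meet trivially, so in the abelian quotient their product
    has order p^2 and is everything. In the other cases the join is a single [line], of order at
    most p. *)
Lemma generating_graphE x y : generating_graph x y =
  [&& x \in ~: Phi, y \in ~: Phi & line x != line y].
Proof.
rewrite /generating_graph /= gen2_line !inE.
case: (boolP (x \in Phi)) => [/line_Phi-> | Px].
  by rewrite joing1G (negPf (line_proper _)) andbF.
case: (boolP (y \in Phi)) => [/line_Phi-> | Py].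
  by rewrite joingG1 (negPf (line_proper _)) andbF.
have [eq_l | ne_l] := eqVneq (line x) (line y).
  by rewrite eq_l /joing setUid genGid (negPf (line_proper _)) andbF.
have -> : x != y by apply: contraNneq ne_l => ->.
have sQ z : line z \subset [set: gT] / Phi.
  by rewrite cycle_subG mem_quotient ?inE.
rewrite eqEcard join_subG !sQ /= cardQ cent_joinEl; last first.
  apply: sub_abelian_cent2 (sQ x) (sQ y).
  exact: abelem_abelian (Phi_quotient_abelem pG).
rewrite TI_cardMg ?card_line ?mulnn ?leqnn //.
apply: prime_TIg; rewrite ?card_line //.
apply: contra ne_l => sub; apply/eqP/val_inj/eqP.
by rewrite eqEcard sub !card_line // leqnn.
Qed.

(** Every nontrivial element of a group of order p generates it, so the part of [x] is the preimage
    of its line without the identity, with fibres of size [#|Phi|]. *)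
Lemma card_line_class x : x \notin Phi ->
  #|[set y in ~: Phi | line y == line x]| = (#|Phi| * p.-1)%N.
Proof.
move=> Px; have -> : [set y in ~: Phi | line y == line x]
    = coset Phi @*^-1 (line x)^#.
  apply/setP=> y.
  rewrite inE in_setC morphpreE in_setI mem_norm_Phi inE in_setD1 /=.
  have -> : (coset Phi y == 1) = (y \in Phi).
    by apply/eqP/idP => [/coset_idr-> //|/coset_id //]; apply: mem_norm_Phi.
  apply: andb_id2l => Py; apply/eqP/idP => [/(congr1 val)/= <- | ly].
    exact: cycle_id.
  apply: val_inj; apply/eqP.
  by rewrite eqEcard cycle_subG ly !card_line // leqnn.
rewrite morphpreD cardsD card_cosetpre card_line // -kerE ker_coset.
have /setIidPr -> : Phi \subset coset Phi @*^-1 line x := sub_cosetpre _.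
by rewrite -subn1 mulnBr muln1.
Qed.

Lemma card_nomem_norm_Phi : #|~: Phi| = (#|Phi| * (p ^ 2).-1)%N.
Proof.
have := cardsC Phi; rewrite -cardsT -(LagrangeI [set: gT] Phi) setTI.
rewrite -card_quotient ?cardQ; last by apply/subsetP=> z _; apply: mem_norm_Phi.
by move/eqP; rewrite -subn1 mulnBr muln1 => /eqP <-; rewrite addKn.
Qed.

End GeneratingGraph.

(** * Order of the Frattini subgroup of a product of two cyclic p-groups *)

Section ProductOfCyclicGroups.
Local Open Scope group_scope.

(** In an abelian p-group Phi is the subgroup ['Mho^1] of p-th powers, and the orders of ['Ohm_1]
    and ['Mho^1] multiply to that of the group; so it suffices to compute the order of ['Ohm_1]. *)
Lemma prod_Zp_p_group (gT : finGroupType) (p e t : nat)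
    (p_prime : prime p) (e_gt0 : (0 < e)%N) (t_gt0 : (0 < t)%N)
    (isoG : [set: gT] \isog [set: 'Z_(p ^ e) * 'Z_(p ^ t)]) :
  [/\ p.-group [set: gT], #|'Phi([set: gT])| = (p ^ (e + t - 2))%N
    & #|[set: gT] / 'Phi([set: gT])| = (p ^ 2)%N].
Proof.
have gt1 k : 0 < k -> 1 < p ^ k.
  by move=> k0; rewrite -{1}(exp1n k) ltn_exp2r ?prime_gt1.
have cardZ k : 0 < k -> #|[set: 'Z_(p ^ k)]| = (p ^ k)%N.
  by move=> k0; rewrite cardsT card_ord Zp_cast ?gt1.
have oG : #|[set: gT]| = (p ^ (e + t))%N.
  by rewrite (card_isog isoG) cardsT card_prod -!cardsT !cardZ // expnD.
have pG : p.-group [set: gT] by rewrite /pgroup oG pnatX pnat_id.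
have abT (hT : finGroupType) :
    (forall x y : hT, commute x y) -> abelian [set: hT].
  by move=> C; apply/centsP=> x _ y _; apply: C.
have ab : abelian [set: gT].
  rewrite (isog_abelian isoG); apply: abT => -[x1 x2] [y1 y2].
  by congr (_, _); apply: Zp_mulgC.
have oOhm (hT : finGroupType) (H : {group hT}) k :
    0 < k -> cyclic H -> #|H| = (p ^ k)%N -> #|'Ohm_1(H)| = p.
  move=> k0 cH oH; apply: Ohm1_cyclic_pgroup_prime => //.
    by rewrite /pgroup oH pnatX pnat_id.
  by rewrite -cardG_gt1 oH gt1.
have cycZ k : cyclic [set: 'Z_k] by rewrite Zp_cycle cycle_cyclic.
have isoX : [set: gT] \isog setX [set: 'Z_(p ^ e)] [set: 'Z_(p ^ t)].
  by rewrite (_ : setX _ _ = setT) //; apply/setP=> u; rewrite !inE.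
(* ['Ohm_1] commutes with direct products, and each cyclic factor contributes p. *)
have oOhmG : #|'Ohm_1([set: gT])| = (p ^ 2)%N.
  rewrite (card_isog (gFisog _ isoX)).
  have /dprod_card <- := Ohm_dprod 1
    (setX_dprod [set: 'Z_(p ^ e)]%G [set: 'Z_(p ^ t)]%G).
  rewrite -morphim_pairg1 -morphim_pair1g.
  by rewrite (oOhm _ _ e) ?(oOhm _ _ t) ?morphim_cyclic ?card_injm
    ?injm_pairg1 ?injm_pair1g ?cardZ //; exact: cycZ.
have oPhi : #|'Phi([set: gT])| = (p ^ (e + t - 2))%N.
  have := mul_card_Ohm_Mho_abelian 1 ab.
  rewrite -(Phi_Mho pG ab) oOhmG oG -{1}(@subnKC 2 (e + t)) ?expnD; last first.
    by rewrite -addn1 leq_add.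
  by move/eqP; rewrite eqn_pmul2l ?expn_gt0 ?prime_gt0 // => /eqP.
split=> //; rewrite card_quotient ?gFnorm // -divgS ?gFsub // oG oPhi.
by rewrite -expnB ?prime_gt0 ?leq_subr // subKn // -addn1 leq_add.
Qed.

End ProductOfCyclicGroups.

(** * The Laplacian spectrum *)

Theorem theorem6p4 (R : numFieldType) (gT : finGroupType) (p e t : nat)
    (p_prime : prime p) (e_gt0 : (0 < e)%N) (t_gt0 : (0 < t)%N)
    (isoG : [set: gT] \isog [set: 'Z_(p ^ e) * 'Z_(p ^ t)]) :
  let alpha := totient (p ^ (e + t - 1)) in
  has_spectrum (laplacian_mx R (@generating_graph gT))
    [:: (0%R, (1 + p ^ (e + t - 2))%N);
        (((p + 1) * alpha)%:R%R, p);
        ((p * alpha)%:R%R, ((p + 1) * (alpha - 1))%N)].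
Proof.
move=> alpha; have [pG oPhi oQ] := prod_Zp_p_group p_prime e_gt0 t_gt0 isoG.
pose V : {set gT} := ~: 'Phi([set: gT])%g; pose g := @line gT.
have p_gt0 := prime_gt0 p_prime.
(* This identifies [alpha] with the common size of the parts. *)
have alphaE : alpha = p ^ (e + t - 2) * p.-1.
  rewrite /alpha totient_pfactor ?subn_gt0 //; last exact: leq_add e_gt0 t_gt0.
  by rewrite -[(_ - _).-1]subn1 -subnDA mulnC.
have card_class : {in V, forall x, #|[set y in V | g y == g x]| = alpha}.
  by move=> x; rewrite inE alphaE -oPhi; apply: card_line_class.
have alpha_gt0 : 0 < alpha by rewrite totient_gt0 expn_gt0 p_gt0.
(* The lines are counted by dividing [#|V|], which is (p^2 - 1) times the order of Phi, by the part
   size [alpha]. *)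
have card_lines : #|g @: V| = p.+1.
  have oV : #|V| = p.+1 * alpha.
    rewrite (card_nomem_norm_Phi oQ) oPhi alphaE mulnCA; congr (_ * _).
    by rewrite -subn1 -[1]/(1 ^ 2) subn_sqr subn1 addn1 mulnC.
  have := card_multipartite card_class; rewrite oV => /eqP.
  by rewrite eqn_pmul2r // => /eqP.
have charL := multipartite_char_poly R (generating_graphE p_prime pG oQ)
  card_class card_lines.
rewrite setCK oPhi in charL.
apply: has_spectrum_char_poly.
  (* The three eigenvalues are distinct because p and [alpha] are positive and the field has
     characteristic 0. *)
  rewrite /= !inE !(eq_sym 0%R) !pnatr_eq0 eqr_nat eqn_pmul2r // !muln_eq0.
  by rewrite addn1 (gtn_eqF p_gt0) (gtn_eqF alpha_gt0) (gtn_eqF (ltnSn p)).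
by rewrite charL !big_cons big_nil /= subr0 mulr1 !addn1 mulrA.
Qed.
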